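(* Let $G$ be a finite group. Then $\mathrm{Com}(G)=\mathrm{SNorm}(G)$ if and only if $G$ does not have a subgroup isomorphic to an SNNC-group.
   Context: Both graphs are simple undirected graphs with vertex set $G$. For distinct $x,y\in G$: $x,y$ are adjacent in the commuting graph $\mathrm{Com}(G)$ iff $xy=yx$; $x,y$ are adjacent in the symmetric normaliser graph $\mathrm{SNorm}(G)$ iff $x\in N(\langle y\rangle)$ and $y\in N(\langle x\rangle)$, where $N(H)$ is the normaliser of the subgroup $H$ in $G$. The graphs are equal when they have the same edge set. Commutators are $[x,y]=xyx^{-1}y^{-1}$ and $[x,y,z]=[[x,y],z]$. A finite group is exponent-critical if its exponent is not the least common multiple of the exponents of its proper non-abelian subgroups. An exponent-critical $p$-group is of type $\mathcal{B}$ if it has more than one abelian maximal subgroup. An SNNC-group (symmetric normaliser non-commuting group) is an exponent-critical $p$-group of type $\mathcal{B}$ ($p$ a prime) which is isomorphic to the quaternion group $Q_8$ of order $8$ or to a group $P$ of order $p^n$ of the form $$P=\langle a,b \mid b^{p^{\beta}}=[a,b]^p=[a,b,a]=[a,b,b]=1,\ a^{p^{\alpha}}=[a,b]\rangle,$$ where $\alpha,\beta$ are integers with $\alpha+\beta=n-1$ and $\alpha\ge\beta\ge 1$, and where moreover, if $p=2$ and $\alpha=\beta$, then $\alpha>1$. *)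

(* Defs.v *)
From mathcomp Require Import all_boot all_fingroup all_solvable.

Set Implicit Arguments.
Unset Strict Implicit.
Unset Printing Implicit Defensive.

Local Open Scope group_scope.

(* The edges of a simple graph are the unordered pairs [set x; y], x != y, of *)
(* adjacent vertices. It is used below with symmetric relations e only.       *)
Definition edges (T : finType) (V : {set T}) (e : rel T) : {set {set T}} :=
  [set [set x; y] | x in V, y in V & (x != y) && e x y].

Definition Com (gT : finGroupType) (G : {group gT}) : {set {set gT}} :=
  edges G (fun x y => x * y == y * x).

Definition SNorm (gT : finGroupType) (G : {group gT}) : {set {set gT}} :=
  edges G (fun x y => (x \in 'N_G(<[y]>)) && (y \in 'N_G(<[x]>))).

(* When G has no proper non-abelian subgroup the lcm is that of the empty     *)
(* family, i.e., 1.                                                           *)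
Definition exponent_critical (gT : finGroupType) (G : {group gT}) : bool :=
  exponent G !=
    \big[lcmn/1%N]_(H : {group gT} | (H \proper G) && ~~ abelian H) exponent H.

Definition typeB (p : nat) (gT : finGroupType) (G : {group gT}) : bool :=
  [&& p.-group G, exponent_critical G
    & 1 < #|[set M : {group gT} | maximal M G && abelian M]|].

(* In relations, [x, y] is x y x^-1 y^-1 and [x, y, z] is [[x, y], z], whereas *)
(* the library's [~ x, y] is x^-1 y^-1 x y.                                    *)
Definition comm_term (x y : Presentation.term) : Presentation.term :=
  Presentation.Mul
    (Presentation.Mul (Presentation.Mul x y) (Presentation.Inv x))
    (Presentation.Inv y).

Notation "[ x1 , x2 , .. , xn ]" :=
  (comm_term .. (comm_term x1 x2) .. xn)
  (in custom group_presentation, x1, x2, xn at level 100).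

(* \isog Grp (...) means isomorphic to the largest finite quotient of the      *)
(* presented group, hence to that group itself when it is finite, as it is    *)
(* here: [a, b] is central of order dividing p, so its order divides          *)
(* p ^ (alpha + beta + 1).                                                    *)
Definition SNNC (gT : finGroupType) (P : {group gT}) : Prop :=
  exists p : nat,
  [/\ prime p, typeB p P &
      P \isog 'Q_8 \/
      exists alpha beta n : nat,
      [/\ (alpha + beta = n - 1)%N, beta <= alpha, 1 <= beta,
          p = 2 -> alpha = beta -> 1 < alpha
        & #|P| = (p ^ n)%N /\
          P \isog Grp (a : b :
            b ^+ (p ^ beta) = 1, [a, b] ^+ p = 1,
            [a, b, a] = 1, [a, b, b] = 1,
            a ^+ (p ^ alpha) = [a, b])]].

(* Main.v *)
Require Import Defs.
From mathcomp Require Import all_boot all_fingroup all_solvable.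

(** Commuting elements normalise each other's cyclic subgroups, so the two
    graphs agree exactly when any x, y in G with x in N(<y>) and y in N(<x>)
    commute ([Com_eq_SNormP]). The condition on x and y says that [~ x, y] lies
    in <x> and in <y> ([mutual_normE]); in particular [~ x, y] is central in
    <x, y>, so <x, y> has class at most 2, powers come out of commutators, and
    (y x)^i = y^i x^i [~ x, y]^'C(i, 2).

    An SNNC-group contains a non-commuting pair of this kind
    ([SNNC_mutual_norm]). In 'Q_8 any two standard generators will do. In the
    presented group P, <a> contains [~ a, b] but <b> does not, and b is replaced
    by y = a^k b with k = p^(alpha - beta): as alpha >= beta, the power
    y^(p^beta) is a^(p^alpha) = [~ a, b] up to the factor
    [~ a, b]^(k * 'C(p^beta, 2)), which is trivial because
    p = 2 and alpha = beta = 1 is excluded.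

    Conversely, let x and y be a non-commuting pair. Some primary components
    of x and y do not commute; they belong to the same prime p, since their
    commutator lies in both cyclic groups, and a suitable power of the first
    one makes c = [~ x, y] have order p ([mutual_norm_prime_pair]). Then <x, y>
    is minimal non-abelian, hence of type B ([typeB_cycles]). Assume
    #[y] <= #[x] and let p^j be the order of y modulo <x>. The inequality of
    the orders yields e such that, up to a power of c, b = x^e y satisfies
    b^(p^j) = 1. If that power is trivial, <x, y> is the semidirect product of
    <x> by <b>, which is the presented group with beta = j and p^(alpha + 1)
    the order of x ([SNNC_split]). If not, p = 2, j = 1 and b^2 = c: then
    <x, y> is 'Q_8 when #[x] = 4, and otherwise multiplying b by a central
    element of order 4 of <x> gives b^2 = 1 ([SNNC_pair]). *)

Set Implicit Arguments.
Unset Strict Implicit.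
Unset Printing Implicit Defensive.

Local Open Scope group_scope.

(** * Mutually normalising elements *)

Definition mutual_norm (gT : finGroupType) (x y : gT) :=
  (x \in 'N(<[y]>)) && (y \in 'N(<[x]>)).

Lemma norm_cycle_comm (gT : finGroupType) (x y : gT) :
  (x \in 'N(<[y]>)) = ([~ x, y] \in <[y]>).
Proof.
rewrite -invgR groupV -(groupMl _ (cycle_id y)) -conjg_mulR.
by rewrite inE -cycleJ cycle_subG.
Qed.

Lemma mutual_normE (gT : finGroupType) (x y : gT) :
  mutual_norm x y = ([~ x, y] \in <[x]>) && ([~ x, y] \in <[y]>).
Proof. by rewrite /mutual_norm andbC !norm_cycle_comm -invgR groupV. Qed.

Lemma mutual_norm_sym (gT : finGroupType) (x y : gT) :
  mutual_norm x y = mutual_norm y x.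
Proof. exact: andbC. Qed.

(** Subgroups of a cyclic group are characteristic in it. *)
Lemma mutual_norm_sub (gT : finGroupType) (x y x' y' : gT) :
  x' \in <[x]> -> y' \in <[y]> -> mutual_norm x y -> mutual_norm x' y'.
Proof.
have sub (u v u' v' : gT) :
    u' \in <[u]> -> v' \in <[v]> -> u \in 'N(<[v]>) -> u' \in 'N(<[v']>).
  rewrite -!cycle_subG => sU sV nvu.
  apply: subset_trans sU (char_norm_trans _ nvu).
  exact: cycle_subgroup_char.
move=> xx' yy' /andP[nxy nyx].
by apply/andP; split; [apply: sub nxy | apply: sub nyx].
Qed.

Lemma Com_eq_SNormP (gT : finGroupType) (G : {group gT}) :
  Com G = SNorm G <->
    {in G &, forall x y, mutual_norm x y -> commute x y}.
Proof.
split=> [eqCS x y Gx Gy nxy | comG].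
  have [-> | neq_xy] := eqVneq x y; first by [].
  have: [set x; y] \in SNorm G.
    apply/imset2P; exists x y => //; rewrite !inE Gx Gy neq_xy /=.
    by have:= nxy; rewrite /mutual_norm !inE.
  rewrite -eqCS => /imset2P[u v Gu].
  rewrite inE => /and3P[Gv _ /eqP cuv] def_xy.
  have: (x \in [set u; v]) && (y \in [set u; v]) by rewrite -def_xy set21 set22.
  rewrite !inE => /andP[/orP[] /eqP ex /orP[] /eqP ey].
  - by rewrite ex ey.
  - by rewrite ex ey.
  - by rewrite ex ey; apply/commute_sym.
  - by rewrite ex ey.
apply/setP=> e; apply/imset2P/imset2P=> -[x y Gx]; rewrite inE.
  case/and3P=> Gy neq_xy /eqP cxy ->{e}.
  exists x y => //; rewrite inE Gy neq_xy /= !in_setI Gx Gy /=.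
  have [c1 c2] : x \in 'C[y] /\ y \in 'C[x] by split; apply/cent1P.
  by rewrite !(subsetP (cent_sub _)) ?cent_cycle.
case/and3P=> Gy neq_xy /andP[].
rewrite !in_setI => /andP[_ nx] /andP[_ ny] ->{e}.
exists x y => //; rewrite inE Gy neq_xy /=.
by apply/eqP/comG => //; apply/andP.
Qed.

(** * Commutators, cyclic subgroups and a binomial coefficient *)

(** The only prime power p^n > 1 for which p does not divide 'C(p^n, 2) is 2
    itself: this is where 'Q_8 and the exclusion of alpha = beta = 1 come
    from. *)
Lemma prime_dvd_bin2 p n :
  prime p -> 0 < n -> (p = 2 -> 1 < n) -> p %| 'C(p ^ n, 2).
Proof.
move=> p_pr n_gt0 p2n; have [p2 | odd_p] := even_prime p_pr.
  subst p; have := p2n erefl; case: n n_gt0 {p2n} => [|[|n]] // _ _.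
  by rewrite bin2 expnS -mulnA mul2n doubleK expnS -mulnA dvdn_mulr.
rewrite bin2odd ?oddX ?odd_p ?orbT // dvdn_mulr //.
by rewrite -(prednK n_gt0) expnS dvdn_mulr.
Qed.

Lemma card_joing_commute (gT : finGroupType) (a b : gT) m n :
    commute a b -> a ^+ m = 1 -> b ^+ n = 1 -> 0 < m -> 0 < n ->
  #|<[a]> <*> <[b]>| <= m * n.
Proof.
move=> cab am bn m_gt0 n_gt0.
have cAB : <[b]> \subset 'C(<[a]>).
  by rewrite cent_cycle cycle_subG; apply/cent1P.
rewrite cent_joinEr //.
apply: leq_trans (leq_mul (_ : #[a] <= m) (_ : #[b] <= n)).
- by rewrite -[#[a]]/#|<[a]>| -[#[b]]/#|<[b]>| mul_cardG leq_pmulr ?cardG_gt0.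
- by rewrite dvdn_leq // order_dvdn am.
- by rewrite dvdn_leq // order_dvdn bn.
Qed.

Lemma joing_cycle_mul (gT : finGroupType) (x y : gT) i :
  <[x]> <*> <[x ^+ i * y]> = <[x]> <*> <[y]>.
Proof.
apply/eqP; rewrite eqEsubset !join_subG !joing_subl !cycle_subG /=.
have sXY (u : gT) : x \in <[x]> <*> <[u]> /\ u \in <[x]> <*> <[u]>.
  by rewrite -!cycle_subG joing_subl joing_subr.
have [Xx Xy] := sXY y; have [Xx' Xz] := sXY (x ^+ i * y).
rewrite groupM ?groupX //= -[X in X \in _](mulKg (x ^+ i)).
by rewrite groupM ?groupV ?groupX.
Qed.

Lemma commg_cycle_mul (gT : finGroupType) (x y : gT) i :
  [~ x, x ^+ i * y] = [~ x, y].
Proof.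
have c1 : [~ x, x ^+ i] = 1 by apply/eqP/commgP/commuteX.
by rewrite commgMJ c1 conj1g mulg1.
Qed.

(** A cyclic p-group has a single subgroup of order p. *)
Lemma cycle_socle p m (gT : finGroupType) (x c : gT) :
    prime p -> 0 < m -> #[x] = (p ^ m)%N -> c \in <[x]> -> #[c] = p ->
  exists2 w, coprime p w & x ^+ (p ^ m.-1) = c ^+ w.
Proof.
move=> p_pr m_gt0 ox cX oc; set a0 := x ^+ _.
have oa0 : #[a0] = p.
  rewrite orderXdiv ox ?dvdn_exp2l ?leq_pred // -{1}(prednK m_gt0) expnS.
  by rewrite mulnK ?expn_gt0 ?prime_gt0.
have : a0 \in <[c]>.
  have -> : <[c]> = <[a0]>.
    apply/eqP; rewrite (eq_subG_cyclic (cycle_cyclic x)).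
    - by rewrite -!orderE oa0 oc.
    - by rewrite cycle_subG.
    by rewrite cycle_subG mem_cycle.
  exact: cycle_id.
case/cycleP=> w def_a0; exists w => //.
rewrite prime_coprime // -oc order_dvdn -def_a0 -order_eq1 oa0.
by rewrite neq_ltn prime_gt1 ?orbT.
Qed.

(** * The presented groups *)

(** For central d, the two conventions for the commutator agree. *)
Lemma comm_term_eq (gT : finGroupType) (x y d : gT) :
    commute x d -> commute y d ->
  (x * y * x^-1 * y^-1 == d) = ([~ x, y] == d).
Proof.
move=> cxd cyd.
rewrite -(can_eq (mulgK (y * x))) -[RHS](can_eq (mulKg (y * x))) -commgC.
by rewrite mulgA !mulgKV (commuteM (commute_sym cyd) (commute_sym cxd)).
Qed.

Definition SNNC_gens p al be (gT : finGroupType) (K : {set gT}) (a b : gT) :=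
  [/\ <[a]> <*> <[b]> = K, b ^+ (p ^ be) = 1, [~ a, b] ^+ p = 1,
      commute b [~ a, b] & a ^+ (p ^ al) = [~ a, b]].

Lemma homg_SNNCP p al be (gT : finGroupType) (K : {set gT}) :
  reflect (exists a b, SNNC_gens p al be K a b)
    (K \homg Grp (a : b :
       b ^+ (p ^ be) = 1, [a, b] ^+ p = 1, [a, b, a] = 1, [a, b, b] = 1,
       a ^+ (p ^ al) = [a, b])).
Proof.
have comm_termP (u v : gT) : u * v * u^-1 * v^-1 = 1 <-> commute v u.
  split=> [/eqP | cvu]; last by rewrite -cvu mulgK mulgV.
  rewrite -eq_mulgV1 => /eqP cuv; apply/commute_sym.
  by rewrite /commute -{2}cuv mulgKV.
apply: (iffP existsP) => [[[a b]] /= | [a [b [defK bp cp cb ap]]]].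
  rewrite /= => /eqP[defK bp]; set d := a * b * a^-1 * b^-1.
  move=> dp /comm_termP cad /comm_termP cbd apd.
  have cd: [~ a, b] = d by apply/eqP; rewrite -comm_term_eq.
  by exists a, b; split; rewrite ?cd.
have ca : commute a [~ a, b] by rewrite -ap; apply: commuteX.
exists (a, b) => /=; apply/eqP.
have -> : a * b * a^-1 * b^-1 = [~ a, b] by apply/eqP; rewrite comm_term_eq.
by congr (_, (_, (_, (_, (_, _))))) => //; apply/comm_termP.
Qed.

(** A semidirect product of cyclic groups is defined by the orders of its two
    generators and the action of the second on the first. *)
Lemma cycle_sdprod_homg (gT rT : finGroupType) (H : {group gT})
    (K : {set rT}) (x b : gT) (x' b' : rT) e :
    <[x]> ><| <[b]> = H -> x ^ b = x ^+ e ->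
    <[x']> <*> <[b']> = K -> x' ^+ #[x] = 1 -> b' ^+ #[b] = 1 ->
    x' ^ b' = x' ^+ e ->
  K \homg H.
Proof.
move=> defH xb defK /eqP; rewrite -order_dvdn => ox' /eqP.
rewrite -order_dvdn => ob' xb'.
have actJ : {in <[x]> & <[b]>, morph_act 'J 'J (eltm ox') (eltm ob')}.
  move=> _ _ /cycleP[i ->] /cycleP[j ->]; rewrite /= !eltmE.
  have conjX (hT : finGroupType) (u v : hT) :
      u ^ v = u ^+ e -> u ^+ i ^ (v ^+ j) = u ^+ (i * e ^ j).
    move=> uv; elim: j => [|j IHj]; first by rewrite conjg1 muln1.
    by rewrite expgSr conjgM IHj conjXg uv -expgM expnS mulnCA.
  by rewrite !conjX // eltmE.
apply/homgP; exists (sdprodm_morphism defH actJ).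
rewrite im_sdprodm !morphim_cycle ?cycle_id //= !eltm_id -defK norm_joinEr //.
by rewrite norms_cycle xb' mem_cycle.
Qed.

(** The order of H forces #[a] and #[b] to be as large as the relations allow
    and <a> to meet <b> trivially, so that H is a semidirect product. *)
Lemma SNNC_gens_isoGrp p al be (gT : finGroupType) (H : {group gT}) (a b : gT) :
    prime p -> #|H| = (p ^ (al + be).+1)%N -> SNNC_gens p al be H a b ->
  H \isog Grp (a : b :
    b ^+ (p ^ be) = 1, [a, b] ^+ p = 1, [a, b, a] = 1, [a, b, b] = 1,
    a ^+ (p ^ al) = [a, b]).
Proof.
move=> p_pr oH gensH; have [defH bp cp cb ap] := gensH.
have powE (hT : finGroupType) (u v : hT) :
    u ^+ (p ^ al) = [~ u, v] -> u ^ v = u ^+ (p ^ al).+1.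
  by move=> uv; rewrite conjg_mulR expgS uv.
have ordE (hT : finGroupType) (u v : hT) :
    u ^+ (p ^ al) = [~ u, v] -> [~ u, v] ^+ p = 1 -> u ^+ (p ^ al.+1) = 1.
  by move=> uv uvp; rewrite expnSr expgM uv.
have ab := powE _ _ _ ap.
have nAB : <[b]> \subset 'N(<[a]>) by rewrite norms_cycle ab mem_cycle.
have defM : <[a]> * <[b]> = H by rewrite -defH norm_joinEr.
have le_oa : #[a] <= p ^ al.+1.
  by rewrite dvdn_leq ?expn_gt0 ?prime_gt0 // order_dvdn (ordE _ _ _ ap cp).
have le_ob : #[b] <= p ^ be.
  by rewrite dvdn_leq ?expn_gt0 ?prime_gt0 // order_dvdn bp.
have := mul_cardG <[a]> <[b]>; rewrite defM oH -!orderE => eq_card.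
have oH_gt0 : 0 < p ^ (al + be).+1 by rewrite expn_gt0 prime_gt0.
have tiAB : <[a]> :&: <[b]> = 1.
  apply/card1_trivg/eqP; rewrite eqn_leq cardG_gt0 andbT.
  rewrite -(leq_pmul2l oH_gt0) -eq_card muln1 -addSn expnD.
  exact: leq_mul.
move: eq_card; rewrite tiAB cards1 muln1 -addSn expnD => eq_card.
have [oa ob] : #[a] = (p ^ al.+1)%N /\ #[b] = (p ^ be)%N.
  have := leqif_mul (leqif_eq le_oa) (leqif_eq le_ob) => -[_].
  rewrite eq_card eqxx -expnD expn_eq0 eqn0Ngt prime_gt0 //=.
  by case/esym/andP=> /eqP-> /eqP->.
have defS : <[a]> ><| <[b]> = H by rewrite sdprodE.
apply: intro_isoGrp => [|rT K]; first by apply/homg_SNNCP; exists a, b.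
case/homg_SNNCP=> a' [b' [defK b'p c'p _ a'p]].
apply: (cycle_sdprod_homg defS ab defK); rewrite ?oa ?ob //.
  exact: ordE a'p c'p.
exact: powE.
Qed.

(** * Non-commuting mutually normalising pairs in SNNC-groups *)

(** The pair is a and y = a^(p^(al - be)) b. *)
Lemma mutual_norm_SNNC_gens p al be (gT : finGroupType) (K : {group gT}) a b :
    prime p -> 0 < be <= al -> (p = 2 -> al = be -> 1 < al) ->
    #|K| = (p ^ (al + be).+1)%N -> SNNC_gens p al be K a b ->
  exists y, [/\ a \in K, y \in K, mutual_norm a y & ~ commute a y].
Proof.
move=> p_pr /andP[be_gt0 le_be_al] p2 oK [defK bp cp cb ap].
have [Ka Kb] : a \in K /\ b \in K.
  by rewrite -defK -!cycle_subG joing_subl joing_subr.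
have ncab : ~ commute a b.
  move=> cab; have c1 : [~ a, b] = 1 by apply/eqP/commgP.
  have:= card_joing_commute cab (etrans ap c1) bp.
  rewrite !expn_gt0 prime_gt0 // -expnD defK oK => /(_ isT isT).
  by rewrite leq_exp2l ?prime_gt1 // ltnn.
have ca : commute a [~ a, b] by rewrite -ap; apply: commuteX.
pose k := (p ^ (al - be))%N; pose y := a ^+ k * b.
have cay : [~ a, y] = [~ a, b] by apply: commg_cycle_mul.
have yp : y ^+ (p ^ be) = [~ a, b].
  have cak : [~ b, a ^+ k] = [~ a, b] ^- k by rewrite -invgR commXg.
  have ck u : commute u [~ a, b] -> commute u ([~ a, b] ^- k).
    by move=> cu; apply/commuteV/commuteX.
  rewrite expMg_Rmul ?cak; first last.
  - by apply/ck/commute_sym/commuteX/commute_sym.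
  - exact: ck.
  rewrite bp mulg1 -expgM -expnD subnK // ap expgVn -expgM.
  have /dvdnP[u ->] : p %| k * 'C(p ^ be, 2).
    have [lt_be_al | le_al_be] := ltnP be al.
      by rewrite dvdn_mulr // /k -(subnSK lt_be_al) expnS dvdn_mulr.
    have eq_al_be : al = be by apply/eqP; rewrite eqn_leq le_al_be.
    by rewrite dvdn_mull // prime_dvd_bin2 // -eq_al_be => /p2 -> //.
  by rewrite mulnC expgM cp expg1n invg1 mulg1.
exists y; split=> //; first by rewrite groupM ?groupX.
  by rewrite mutual_normE cay -{2}yp -ap !mem_cycle.
by move/commgP/eqP; rewrite cay => /eqP/commgP.
Qed.

Lemma mutual_norm_Q8 (gT : finGroupType) (K : {group gT}) :
    K \isog 'Q_8 ->
  exists x y, [/\ x \in K, y \in K, mutual_norm x y & ~ commute x y].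
Proof.
move=> isoK.
have oK : #|K| = 8 by rewrite (card_isog isoK) (@card_quaternion 3).
have := isog_hom isoK; rewrite (@Grp_quaternion 3) // => /existsP[[x y]] /=.
case/eqP => defK x4 y2 xy; exists x, y.
have [Kx Ky] : x \in K /\ y \in K.
  by rewrite -defK -!cycle_subG joing_subl joing_subr.
have cxy : [~ x, y] = x ^- 2 by rewrite /commg xy expgS expg1 invMg.
split=> //.
  by rewrite mutual_normE cxy -{2}y2 !groupV !mem_cycle.
move=> cxy'; have/commgP := cxy'; rewrite cxy invg_eq1 => /eqP x2.
have := card_joing_commute cxy' x2 (etrans y2 x2) isT isT.
by rewrite defK oK.
Qed.

Lemma SNNC_mutual_norm (gT : finGroupType) (H : {group gT})
      (rT : finGroupType) (P : {group rT}) :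
    SNNC P -> H \isog P ->
  exists x y, [/\ x \in H, y \in H, mutual_norm x y & ~ commute x y].
Proof.
move=> [p [p_pr _ [isoP | [al [be [n defs]]]]]] isoH.
  exact: mutual_norm_Q8 (isog_trans isoH isoP).
case: defs => def_n le_be_al be_gt0 p2 [oP /isoGrp_hom homP].
have := homGrp_trans (isog_hom isoH) homP => /homg_SNNCP[a [b gens]].
have oH : #|H| = (p ^ (al + be).+1)%N.
  rewrite (card_isog isoH) oP def_n subn1 prednK //.
  by apply: leq_trans (leq_pred n); rewrite -subn1 -def_n ltn_addl.
have [] := mutual_norm_SNNC_gens p_pr _ p2 oH gens; first by apply/andP.
by move=> y ?; exists a, y.
Qed.

(** * SNNC-subgroups from non-commuting pairs *)

(** The group H is minimal non-abelian: its Frattini subgroup is central and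
    of index at most p^2, so a maximal subgroup is cyclic modulo a central
    subgroup. Hence the lcm in the definition of exponent-critical is that of
    the empty family. Maximal subgroups containing x and y respectively are
    distinct, as x and y generate H. *)
Lemma typeB_cycles p (gT : finGroupType) (x y : gT) :
    prime p -> p.-group (<[x]> <*> <[y]>) ->
    commute x [~ x, y] -> commute y [~ x, y] ->
    [~ x, y] ^+ p = 1 -> [~ x, y] != 1 ->
  typeB p (<[x]> <*> <[y]>).
Proof.
move=> p_pr pH cx cy cp nt_c; set H := (<[x]> <*> <[y]>)%G.
have [Hx Hy] : x \in H /\ y \in H by rewrite -!cycle_subG joing_subl joing_subr.
have cH : [~ x, y] \in 'C(H).
  rewrite -sub_cent1 join_subG !cycle_subG.
  by apply/andP; split; apply/cent1P/commute_sym.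
have der1H : H^`(1) = <[[~ x, y]]> by apply: der1_joing_cycles.
have sPhiZ : 'Phi(H) \subset 'Z(H).
  rewrite (Phi_joing pH) join_subG der1H cycle_subG inE groupR // cH /=.
  rewrite (MhoE _ pH) gen_subG; apply/subsetP=> _ /imsetP[g Hg ->].
  rewrite inE groupX //=; apply/centP=> h Hh; apply/commgP.
  have: [~ g, h] \in H^`(1) by apply: mem_commg.
  rewrite der1H => /cycleP[i cgh]; rewrite commXg cgh.
    by rewrite -expgM mulnC expgM cp expg1n.
  by apply/commuteX/commute_sym; apply: (centP cH).
have max_abelian (M : {group gT}) : maximal M H -> abelian M.
  move=> maxM; have sPhiM := Phi_sub_max maxM.
  have [ltMH _] := maxgroupP maxM; have sMH := proper_sub ltMH.
  apply: (cyclic_factor_abelian (H := 'Phi(H))).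
    by rewrite subsetI sPhiM (subset_trans sPhiZ) // subIset // centS ?orbT.
  have leHp : #|H / 'Phi(H)| <= p * p.
    have [abHb expHb] := abelemP p_pr (Phi_quotient_abelem pH).
    have mem_bar u : u \in H -> coset 'Phi(H) u \in H / 'Phi(H).
      exact: mem_quotient.
    have nPhi := subsetP (normal_norm (Phi_normal H)).
    rewrite quotientY ?cycle_subG ?nPhi // !quotient_cycle ?nPhi //.
    apply: card_joing_commute; rewrite ?expHb ?mem_bar ?prime_gt0 //.
    by apply: (centsP abHb); apply: mem_bar.
  have leMp : #|M / 'Phi(H)| <= p.
    rewrite -(leq_pmul2l (prime_gt0 p_pr)) -{1}(p_maximal_index pH maxM) mulnC.
    have nPhiH := normal_norm (Phi_normal H).
    have nPhiM := subset_trans sMH nPhiH.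
    by rewrite card_quotient // mulnC Lagrange_index // -card_quotient.
  have [k oMb] := p_natP (quotient_pgroup 'Phi(H) (pgroupS sMH pH)).
  case: k oMb => [|[|k]] oMb.
  - by rewrite (card1_trivg oMb) cyclic1.
  - by rewrite prime_cyclic // oMb.
  by have:= leMp; rewrite oMb -{2}(expn1 p) leq_exp2l ?prime_gt1.
have nabH : ~~ abelian H.
  apply: contra nt_c => abH; apply/commgP; exact: (centsP abH).
have cycle_max u : u \in H -> exists2 M : {group gT}, maximal M H & u \in M.
  rewrite -cycle_subG => /maximal_exists[defH | [M maxM uM]].
    by case/negP: nabH; rewrite -defH cycle_abelian.
  by exists M; rewrite // -cycle_subG.
apply/and3P; split=> //.
  rewrite /exponent_critical big_pred0 => [|M]; last first.
    apply/negbTE; rewrite negb_and negbK.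
    have [ltMH /=| //] := boolP (M \proper H).
    have [eqMH | [M1 maxM1 sMM1]] := maximal_exists (proper_sub ltMH).
      by have:= ltMH; rewrite eqMH properxx.
    exact: abelianS (max_abelian _ maxM1).
  rewrite -dvdn1 -trivg_exponent; apply: contra nabH => /eqP ->.
  exact: abelian1.
have [M1 maxM1 M1x] := cycle_max x Hx; have [M2 maxM2 M2y] := cycle_max y Hy.
have neqM12 : M1 != M2.
  apply/eqP=> eqM12; have [ltMH _] := maxgroupP maxM1.
  have:= ltMH; rewrite properE join_subG !cycle_subG M1x eqM12 M2y.
  by rewrite andbF.
have <- : #|[set M1; M2]| = 2 by rewrite cards2 neqM12.
apply/subset_leq_card/subsetP=> M; rewrite !inE.
by case/orP=> /eqP ->; rewrite ?maxM1 ?maxM2 max_abelian.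
Qed.

(** Here [~ x, b] generates the subgroup of order p of <x>, but the
    presentation asks for the generator x^(p^(m - 1)) of that subgroup: a
    power of b prime to p achieves this. *)
Lemma SNNC_split p m j (gT : finGroupType) (H : {group gT}) (x b : gT) :
    prime p -> 0 < j < m -> (p = 2 -> m = 2 -> 1 < j) ->
    #|H| = (p ^ (m + j))%N -> #[x] = (p ^ m)%N -> b ^+ (p ^ j) = 1 ->
    <[x]> <*> <[b]> = H -> [~ x, b] \in <[x]> -> [~ x, b] ^+ p = 1 ->
    [~ x, b] != 1 -> commute b [~ x, b] ->
  SNNC H.
Proof.
move=> p_pr /andP[j_gt0 lt_jm] p2 oH ox bp defH cX cp nt_c cb.
have m_gt0 : 0 < m := leq_ltn_trans (leq0n j) lt_jm.
have cx : commute x [~ x, b] by have /cycleP[i ->] := cX; apply/commuteX.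
have pH : p.-group H by rewrite /pgroup oH pnatX pnat_id.
have typH : typeB p H.
  have := typeB_cycles p_pr _ cx cb cp nt_c.
  by case: H pH defH {oH} => [H gH] /= pH defH; subst H; apply.
exists p; split=> //; right; exists m.-1, j, (m + j)%N.
split=> //.
- by rewrite -{2}(prednK m_gt0) addSn subn1.
- by rewrite -ltnS prednK.
- move=> p_2 eq_mj.
  case: m m_gt0 lt_jm p2 {ox oH} eq_mj => [|[|[|m]]] //= _ lt_jm p2.
    by move=> def_j; rewrite -def_j in j_gt0.
  by move=> def_j; have := p2 p_2 erefl; rewrite -def_j.
split=> //.
have oc : #[[~ x, b]] = p by apply: nt_prime_order.
have [w pw def_w] := cycle_socle p_pr m_gt0 ox cX oc.
have cw : [~ x, b ^+ w] = x ^+ (p ^ m.-1) by rewrite commgX.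
apply: (@SNNC_gens_isoGrp p m.-1 j gT H x (b ^+ w)) => //.
  by rewrite -addSn prednK.
have eq_bw : <[b]> = <[b ^+ w]>.
  apply/eqP; rewrite -[_ == _]/(generator _ _) generator_coprime.
  by rewrite (@coprime_dvdl _ (p ^ j)) ?coprimeXl // order_dvdn bp.
split=> //; first by rewrite -eq_bw.
- by rewrite -expgM mulnC expgM bp expg1n.
- by rewrite cw def_w -expgM mulnC expgM cp expg1n.
- by rewrite cw def_w; apply/commuteX/commute_sym/commuteX/commute_sym.
Qed.

Lemma SNNC_pair p (gT : finGroupType) (x y : gT) :
    prime p -> p.-elt x -> p.-elt y -> mutual_norm x y ->
    [~ x, y] ^+ p = 1 -> [~ x, y] != 1 -> #[y] <= #[x] ->
  SNNC (<[x]> <*> <[y]>).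
Proof.
move=> p_pr px py; rewrite mutual_normE => /andP[cX cY] cp nt_c le_yx.
have cx : commute x [~ x, y] by have /cycleP[i ->] := cX; apply/commuteX.
have cy : commute y [~ x, y] by have /cycleP[i ->] := cY; apply/commuteX.
set c := [~ x, y] in cX cY cp nt_c cx cy *.
have nXy : y \in 'N(<[x]>) by rewrite norm_cycle_comm -invgR groupV.
have nXY : <[y]> \subset 'N(<[x]>) by rewrite cycle_subG.
set H := (<[x]> <*> <[y]>)%G.
have [m ox] := p_natP px; have [s oy] := p_natP py.
have le_sm : s <= m by rewrite -(leq_exp2l _ _ (prime_gt1 p_pr)) -ox -oy.
have [j oyX] := p_natP (morph_p_elt (coset_morphism <[x]>) nXy py).
(* The image of y in H / <x> has order p^j. *)
have memXy i : (y ^+ i \in <[x]>) = (p ^ j %| i).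
  rewrite -oyX order_dvdn -morphX //=.
  apply/idP/eqP; first exact: coset_id.
  by apply: coset_idr; rewrite groupX.
have oH : #|H| = (p ^ (m + j))%N.
  have nXH : H \subset 'N(<[x]>) by rewrite join_subG normG.
  rewrite -(Lagrange (joing_subl _ _ : <[x]> \subset H)) -card_quotient //.
  by rewrite quotientYidl // quotient_cycle // -!orderE ox oyX expnD.
have j_gt0 : 0 < j.
  rewrite lt0n; apply: contra nt_c => /eqP j0; apply/commgP.
  have: y ^+ 1 \in <[x]> by rewrite memXy j0.
  by case/cycleP=> i; rewrite expg1 => ->; apply: commuteX.
(* The intersection of <x> and <y> contains c, so y^(p^j) is non-trivial. *)
have lt_js : j < s.
  rewrite ltnNge; apply: contra nt_c => le_sj; have /cycleP[i def_c] := cY.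
  have: y ^+ i \in <[x]> by rewrite -def_c.
  rewrite memXy def_c -order_dvdn oy; apply: dvdn_trans.
  exact: dvdn_exp2l.
have lt_jm := leq_trans lt_js le_sm.
(* As #[y] <= #[x], the orders force the exponent of x in y^- (p^j) to be a
   multiple of p^j. *)
have [e def_e] : exists e, x ^+ (e * p ^ j) = y ^- (p ^ j).
  have: y ^- (p ^ j) \in <[x]> by rewrite groupV memXy.
  case/cycleP=> k def_k.
  have/eqP: x ^+ (k * p ^ (s - j)) = 1.
    rewrite expgM -def_k expgVn -expgM -expnD subnKC 1?ltnW //.
    by rewrite -oy expg_order invg1.
  have def_m : m = (m - s + j + (s - j))%N.
    by rewrite -addnA subnKC 1?ltnW // subnK.
  rewrite -order_dvdn ox {1}def_m expnD.
  rewrite dvdn_pmul2r ?expn_gt0 ?prime_gt0 // expnD.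
  case/dvdnP=> q def_q.
  by exists (q * p ^ (m - s))%N; rewrite def_k def_q mulnA.
pose z := x ^+ e * y.
have cxz : [~ x, z] = c by apply: commg_cycle_mul.
have defHz : <[x]> <*> <[z]> = H by apply: joing_cycle_mul.
have zp : z ^+ (p ^ j) = c ^- (e * 'C(p ^ j, 2)).
  have cye : [~ y, x ^+ e] = c ^- e by rewrite -invgR commXg.
  have ck u : commute u c -> commute u (c ^- e).
    by move=> cu; apply/commuteV/commuteX.
  rewrite expMg_Rmul ?cye; first last.
  - by apply/ck/commute_sym/commuteX/commute_sym.
  - exact: ck.
  by rewrite -expgM def_e mulVg mul1g expgVn -expgM.
have cz : commute z c.
  by apply/commute_sym/commuteM; first apply: commuteX; apply: commute_sym.
have [dvd_p | ] := boolP (p %| e * 'C(p ^ j, 2)).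
  apply: (SNNC_split p_pr _ _ oH ox _ defHz); rewrite ?cxz ?j_gt0 //.
    (* If #[x] = 4 and j = 1 then e is even, so y^2 = 1: the dihedral group of
       order 8 does not arise. *)
    move=> p2 m2; rewrite ltnNge; apply/negP=> le_j1.
    have j1 : j = 1%N by apply/eqP; rewrite eqn_leq le_j1.
    have: ~~ (#[y] %| p ^ j).
      by rewrite oy dvdn_Pexp2l ?prime_gt1 // -ltnNge.
    rewrite order_dvdn -invg_eq1 -def_e -order_dvdn ox p2 m2 j1.
    by move: dvd_p; rewrite p2 j1 muln1 (dvdn_pmul2r (d := 2)) // => ->.
  by rewrite zp; case/dvdnP: dvd_p => u ->; rewrite mulnC expgM cp expg1n invg1.
rewrite Euclid_dvdM // negb_or => /andP[p_e p_bin].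
have p2 : p = 2.
  by apply/eqP; apply: contraR p_bin => /eqP p2; apply: prime_dvd_bin2.
have j1 : j = 1%N.
  apply/eqP; rewrite eqn_leq j_gt0 andbT leqNgt.
  by apply: contra p_bin => j_gt1; apply: prime_dvd_bin2.
(* From here on c has order 2 and z^2 = c. *)
have odd_pow w : coprime p w -> c ^+ w = c.
  rewrite p2 coprime2n => odd_w.
  have oc : #[c] = 2 by rewrite -p2; apply: nt_prime_order.
  by rewrite -(expg_mod_order c) oc modn2 odd_w.
have cV : c^-1 = c by apply/eqP; rewrite eq_invg_mul -[_ * _]/(c ^+ 2) -p2 cp.
have z2 : z ^+ 2 = c.
  by move: zp; rewrite p2 j1 muln1 => ->; rewrite odd_pow // prime_coprime.
have oc : #[c] = p by apply: nt_prime_order.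
have m_gt0 : 0 < m := leq_ltn_trans (leq0n j) lt_jm.
have [w pw] := cycle_socle p_pr m_gt0 ox cX oc.
rewrite odd_pow // p2 => xm.
have [m2 | m_neq2] := eqVneq m 2.
  have x2 : x ^+ 2 = c by rewrite -xm m2.
  have pH : p.-group H by rewrite /pgroup oH pnatX pnat_id.
  exists p; split=> //; first exact: typeB_cycles.
  left; rewrite isogEcard (@card_quaternion 3) // oH p2 m2 j1 andbT.
  rewrite (@Grp_quaternion 3) //; apply/existsP; exists (x, z); apply/eqP.
  have x4 : x ^+ 4 = 1 by rewrite (expgM x 2 2) x2 -p2 cp.
  rewrite /= z2 x2 defHz x4.
  rewrite conjg_mulR cxz; congr (_, (_, (_, _))).
  by apply/eqP; rewrite eq_sym eq_invg_mul -x2 -!expgS -order_dvdn ox p2 m2.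
have m_gt2 : 2 < m by rewrite ltn_neqAle eq_sym m_neq2 -j1.
(* The element x^(2^(m - 2)) is central because m > 2, and its square is c. *)
pose b := x ^+ (2 ^ m.-2) * z.
have cxb : [~ x, b] = c by rewrite commg_cycle_mul.
have defHb : <[x]> <*> <[b]> = H by rewrite joing_cycle_mul.
apply: (SNNC_split p_pr _ _ oH ox _ defHb); rewrite ?cxb ?j_gt0 //.
- by move=> _ m2; rewrite m2 in m_neq2.
- rewrite p2 j1 expgMn.
    rewrite z2 -expgM -expnSr prednK ?xm //.
      by rewrite -{2}cV mulgV.
    by rewrite -subn1 subn_gt0 ltnW.
  apply/commgP; rewrite commXg cxz //.
  by rewrite -(subnKC m_gt2) expnS expgM -{1}p2 cp expg1n.
- apply/commute_sym/commuteM; last exact: commute_sym.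
  by apply/commuteX/commute_sym.
Qed.

Lemma constt_not_commute (gT : finGroupType) (x y : gT) :
  [~ x, y] != 1 -> exists p : nat, [~ x.`_p, y] != 1.
Proof.
move=> ncxy; have /existsP[p ncp] :
    [exists p : 'I_#[x].+1, [~ x.`_p, y] != 1].
  apply: contraR ncxy => /existsPn-cp; apply/commgP/cent1P.
  rewrite -[x]prod_constt big_mkord; apply: group_prod => i _.
  by apply/cent1P/commgP; have := cp i; rewrite negbK.
by exists p.
Qed.

(** Elements of coprime orders that normalise each other's cyclic subgroups
    commute, so non-commuting primary components of x and y belong to the same
    prime. *)
Lemma mutual_norm_prime_pair (gT : finGroupType) (x y : gT) :
    mutual_norm x y -> [~ x, y] != 1 ->
  exists p x' y',
    [/\ x' \in <[x]>, y' \in <[y]>, [~ x', y'] ^+ p = 1 & [~ x', y'] != 1] /\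
    [/\ prime p, p.-elt x', p.-elt y' & mutual_norm x' y'].
Proof.
move=> nxy /constt_not_commute[p ncp].
have [q] : exists q : nat, [~ y.`_q, x.`_p] != 1.
  by apply: constt_not_commute; rewrite -invgR invg_eq1.
rewrite -invgR invg_eq1.
set u := x.`_p; set v := y.`_q; set c := [~ u, v] => nt_c.
have [xu yv] : u \in <[x]> /\ v \in <[y]> by rewrite !groupX ?cycle_id.
have [pu qv] : p.-elt u /\ q.-elt v by rewrite !p_elt_constt.
have nuv := mutual_norm_sub xu yv nxy.
have := nuv; rewrite mutual_normE -/c => /andP[cU cV].
have eq_qp : q = p.
  apply: contraNeq nt_c => neq_qp; rewrite -cycle_eq1 -subG1.
  have <- : <[u]> :&: <[v]> = 1.
    apply/coprime_TIg/(pnat_coprime pu)/(pi_pnat qv).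
    by rewrite !inE.
  by rewrite cycle_subG inE cU.
have [|p_pr _ [k]] := pgroup_pdiv (mem_p_elt pu cU : p.-group <[c]>).
  by rewrite cycle_eq1.
rewrite -orderE => oc.
have cuk : [~ u ^+ (p ^ k), v] = c ^+ (p ^ k).
  by apply: commXg; rewrite -/c; have /cycleP[i ->] := cU; apply: commuteX.
exists p, (u ^+ (p ^ k)), v; split.
  rewrite cuk -order_eq1 groupX // -expgM -expnSr -oc expg_order; split=> //.
  rewrite orderXdiv oc ?dvdn_exp2l // expnSr mulKn ?expn_gt0 ?prime_gt0 //.
  by rewrite neq_ltn prime_gt1 ?orbT.
split=> //; [exact: p_eltX | by rewrite -eq_qp | ].
exact: mutual_norm_sub (mem_cycle _ _) (cycle_id _) nuv.
Qed.

Theorem theorem2 (gT : finGroupType) (G : {group gT}) :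
  Com G = SNorm G <->
  ~ (exists H : {group gT}, H \subset G /\
       exists (rT : finGroupType) (P : {group rT}), SNNC P /\ (H \isog P)%g).
Proof.
split=> [/Com_eq_SNormP-comG [H [sHG [rT [P [snncP isoH]]]]] | noH].
  have [x [y [Hx Hy nxy]]] := SNNC_mutual_norm snncP isoH; apply.
  by apply: comG nxy; apply: (subsetP sHG).
apply/Com_eq_SNormP=> x y Gx Gy nxy; apply/commgP/idPn => nc; case: noH.
have [p [u [v [[xu yv cp nt_c] [p_pr pu pv nuv]]]]] :=
  mutual_norm_prime_pair nxy nc.
have Gu : u \in G by apply: subsetP xu; rewrite cycle_subG.
have Gv : v \in G by apply: subsetP yv; rewrite cycle_subG.
have [le_vu | lt_uv] := leqP #[v] #[u].
  exists (<[u]> <*> <[v]>)%G; rewrite join_subG !cycle_subG Gu Gv; split=> //.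
  exists gT, (<[u]> <*> <[v]>)%G; split; last exact: isog_refl.
  exact: (SNNC_pair p_pr).
exists (<[v]> <*> <[u]>)%G; rewrite join_subG !cycle_subG Gu Gv; split=> //.
exists gT, (<[v]> <*> <[u]>)%G; split; last exact: isog_refl.
apply: (SNNC_pair p_pr) => //; last exact: ltnW.
- by rewrite mutual_norm_sym.
- by rewrite -invgR expgVn cp invg1.
- by rewrite -invgR invg_eq1.
Qed.
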